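(* Let $X,Y$ be separable Banach spaces and $p,q\in[1,+\infty)$. If $E(X,p)\le_B E(Y,q)$, then $X$ finitely H\''older$(\frac{p}{q})$ embeds into $\ell_q(Y)$.
   Context: For a Banach space $Y$ and $q\in[1,\infty)$, $\ell_q(Y)$ is the Banach space of sequences $x\in Y^{\mathbb N}$ with $\|x\|_{Y,q}=(\sum_n\|x(n)\|_Y^q)^{1/q}<\infty$. For a separable Banach space $X$ and $p\in[1,\infty)$, $E(X,p)$ is the equivalence relation on the Polish space $X^{\mathbb N}$ given by $(x,y)\in E(X,p)\iff\sum_{n}\|x(n)-y(n)\|_X^p<+\infty$. $E\le_B F$ means there is a Borel map $\theta$ between the underlying Polish spaces with $(x,y)\in E\iff(\theta(x),\theta(y))\in F$. For metric spaces $(M,d),(M',d')$ and $\alpha>0$, $M$ finitely H\''older$(\alpha)$ embeds into $M'$ if there is $A>0$ such that for every finite $F\subseteq M$ there is a map $T_F:F\to M'$ with $\frac1A d(u,v)^\alpha\le d'(T_F(u),T_F(v))\le A d(u,v)^\alpha$ for all $u,v\in F$. *)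

(* Defs.v *)
(* Banach spaces are real: completeNormedModType R for an arbitrary R : realType. *)
From HB Require Import structures.
From mathcomp Require Import all_boot all_order all_algebra.
From mathcomp Require Import all_classical all_reals all_analysis.

Set Implicit Arguments.
Unset Strict Implicit.
Unset Printing Implicit Defensive.

Import Order.TTheory GRing.Theory Num.Theory.
Import numFieldNormedType.Exports.

Local Open Scope classical_set_scope.
Local Open Scope ring_scope.

Definition separable_space (T : topologicalType) : Prop :=
  exists2 D : set T, countable D & dense D.

Definition borel_set (T : topologicalType) : set (set T) := <<s @open T >>.

Definition borel_map (S T : topologicalType) (f : S -> T) : Prop :=
  forall B : set T, borel_set B -> borel_set (f @^-1` B).

Definition borel_reducible (S T : topologicalType)
    (E : S -> S -> Prop) (F : T -> T -> Prop) : Prop :=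
  exists theta : S -> T,
    borel_map theta /\ forall x y, E x y <-> F (theta x) (theta y).

Definition pow_series (R : realType) (V : normedModType R) (p : R)
    (x : nat -> V) : \bar R :=
  (\sum_(0 <= n <oo) (`|x n| `^ p)%:E)%E.

(* {ptws nat -> X} is nat -> X equipped with the product topology. *)
Definition E_rel (R : realType) (X : normedModType R) (p : R)
    (x y : {ptws nat -> X}) : Prop :=
  (\sum_(0 <= n <oo) (`|x n - y n| `^ p)%:E < +oo)%E.

(* (M, d) and (M', d') are meant to be metric spaces, given by their distance
   functions (in the library a normed module is not canonically a metricType). *)
Definition finitely_holder_embeds (R : realType) (alpha : R)
    (M : Type) (d : M -> M -> R) (M' : Type) (d' : M' -> M' -> R) : Prop :=
  exists2 A : R, 0 < A &
    forall F : set M, finite_set F ->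
      exists T : set_type F -> M', forall u v : set_type F,
        A^-1 * d (set_val u) (set_val v) `^ alpha <= d' (T u) (T v) /\
        d' (T u) (T v) <= A * d (set_val u) (set_val v) `^ alpha.

Definition norm_dist (R : realType) (V : normedModType R) (u v : V) : R :=
  `|u - v|.

Definition lq_pred (R : realType) (Y : normedModType R) (q : R) :
    {pred nat -> Y} :=
  mem [set x : nat -> Y | (pow_series q x < +oo)%E].
Arguments lq_pred {R} Y q.

(* The proof of 1 <= q is a parameter of the type so that the normed space
   structure declared below can be inferred from it. *)
Record lq (R : realType) (Y : normedModType R) (q : R) (q1 : 1 <= q) : Type :=
  Lq { lq_val :> nat -> Y ; lq_valP : lq_val \in lq_pred Y q }.
Arguments lq {R} Y {q} q1.

Section lq_space.
Context (R : realType) (Y : normedModType R) (q : R) (q1 : 1 <= q).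
Implicit Types (x y : nat -> Y).

HB.instance Definition _ := [isSub for @lq_val R Y q q1].
HB.instance Definition _ := [Choice of lq Y q1 by <:].

Let q_gt0 : 0 < q. Proof. exact: lt_le_trans ltr01 q1. Qed.

Lemma pow_series_ge0 x : (0 <= pow_series q x)%E.
Proof. by apply: nneseries_ge0 => n _ _; rewrite lee_fin powR_ge0. Qed.

Lemma pow_series0 : pow_series q (0 : nat -> Y) = 0%E.
Proof.
by apply: eseries0 => n _ _; rewrite /= normr0 powR0// gt_eqF.
Qed.

Lemma pow_seriesZ (a : R) x :
  pow_series q (a *: x) = ((`|a| `^ q)%:E * pow_series q x)%E.
Proof.
rewrite /pow_series -nneseriesZl; last by move=> n _; rewrite lee_fin powR_ge0.
by apply: eq_eseriesr => n _; rewrite -EFinM -powRM// -normrZ.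
Qed.

Lemma pow_series_Lnorm x :
  (pow_series q x `^ q^-1 =
   'N[@counting nat R]_q%:E[EFin \o (fun n => `|x n|%R)])%E.
Proof.
rewrite Lnorm_counting//; congr (_ `^ _)%E; apply: eq_eseriesr => n _ /=.
by rewrite normr_id.
Qed.

Lemma pow_series_minkowski x y :
  (pow_series q (x + y)%R `^ q^-1 <=
   pow_series q x `^ q^-1 + pow_series q y `^ q^-1)%E.
Proof.
rewrite (pow_series_Lnorm x) (pow_series_Lnorm y).
apply: (@le_trans _ _ ('N[@counting nat R]_q%:E[
  EFin \o ((fun n => `|x n|%R) \+ (fun n => `|y n|%R))%R])%E).
  rewrite pow_series_Lnorm !Lnorm_counting//.
  apply: gt0_ler_poweR; rewrite ?invr_ge0 ?(ltW q_gt0)//.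
  - by rewrite in_itv/= leey andbT nneseries_ge0// => n _ _; exact: poweR_ge0.
  - by rewrite in_itv/= leey andbT nneseries_ge0// => n _ _; exact: poweR_ge0.
  - apply: lee_nneseries => [n _ _|n _]; first exact: poweR_ge0.
    rewrite /= lee_fin ge0_ler_powR ?(ltW q_gt0) ?nnegrE//.
    by rewrite normr_id ger0_norm ?addr_ge0// ler_normD.
by apply: minkowski_EFin.
Qed.

Lemma lq_submod_closed : submod_closed (lq_pred Y q).
Proof.
split=> [|a x y]; first by rewrite inE/= pow_series0.
rewrite !inE/= => xq yq; apply: (@lty_poweRy _ _ q^-1).
  by rewrite gt_eqF// invr_gt0.
apply: (le_lt_trans (pow_series_minkowski _ _)).
rewrite lte_add_pinfty// poweR_lty// pow_seriesZ.
by rewrite lte_mul_pinfty// lee_fin powR_ge0.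
Qed.

HB.instance Definition _ :=
  GRing.isSubmodClosed.Build R (nat -> Y) (lq_pred Y q) lq_submod_closed.
HB.instance Definition _ := [SubChoice_isSubLmodule of lq Y q1 by <:].

Definition lq_norm (x : lq Y q1) : R := fine (pow_series q x) `^ q^-1.

Lemma lq_norm_EFin (x : lq Y q1) :
  (lq_norm x)%:E = (pow_series q x `^ q^-1)%E.
Proof.
rewrite /lq_norm -poweR_EFin fineK// ge0_fin_numE ?pow_series_ge0//.
by have := lq_valP x; rewrite inE.
Qed.

Lemma lq_normD (x y : lq Y q1) : lq_norm (x + y) <= lq_norm x + lq_norm y.
Proof.
have := pow_series_minkowski (lq_val x) (lq_val y).
rewrite -(lq_norm_EFin x) -(lq_norm_EFin y).
have -> : (pow_series q (lq_val x + lq_val y)%R `^ q^-1 =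
    (lq_norm (x + y)%R)%:E)%E by rewrite (lq_norm_EFin (x + y)).
by rewrite -EFinD lee_fin.
Qed.

Lemma lq_normZ (a : R) (x : lq Y q1) : lq_norm (a *: x) = `|a| * lq_norm x.
Proof.
have /(congr1 (fun z => z `^ q^-1)%E) := pow_seriesZ a (lq_val x).
have -> : (pow_series q (a *: lq_val x)%R `^ q^-1 =
    (lq_norm (a *: x)%R)%:E)%E by rewrite (lq_norm_EFin (a *: x)).
rewrite poweRM ?lee_fin ?powR_ge0 ?pow_series_ge0// -(lq_norm_EFin x).
rewrite poweR_EFin -powRrM mulfV ?gt_eqF// powRr1// -EFinM.
exact: EFin_inj.
Qed.

Lemma lq_norm_eq0 (x : lq Y q1) : lq_norm x = 0 -> x = 0.
Proof.
move=> /eqP; rewrite /lq_norm powR_eq0 => /andP[/eqP fx0 _].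
have x0 : pow_series q (lq_val x) = 0%E.
  rewrite -(@fineK _ (pow_series q (lq_val x))) ?fx0//.
  rewrite ge0_fin_numE ?pow_series_ge0//.
  by have := lq_valP x; rewrite inE.
apply/val_inj/funext => n /=.
apply/eqP; rewrite -normr_eq0.
have xn0 : ((`|x n| `^ q)%:E <= 0)%E.
  rewrite -x0; apply: le_trans (nneseries_lim_ge n.+1 _) => /=; last first.
    by move=> k _ _; rewrite lee_fin powR_ge0.
  by rewrite big_nat_recr//= leeDr// sume_ge0// => k _; rewrite lee_fin powR_ge0.
have /eqP : `|x n| `^ q = 0.
  by apply/eqP; rewrite eq_le powR_ge0 andbT -lee_fin.
by rewrite powR_eq0 => /andP[].
Qed.

HB.instance Definition _ :=
  Lmodule_isNormed.Build R (lq Y q1) lq_normD lq_normZ lq_norm_eq0.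

End lq_space.

(* Main.v *)
(* Suppose X does not embed: for each n there is a finite set F_n in X with no
   Hölder(p/q) embedding into l_q(Y) of distortion 4^(n/q).  Let f enumerate
   the union of small multiples lam_n F_n.  By the Baire category argument of
   Dougherty and Hjorth, a Borel reduction theta becomes, after fixing all but
   a sparse set of coordinates, coordinatewise up to an l_q-summable error:
   there are maps T_j from the finite set allowed at the j-th free coordinate
   to finite blocks of Y^N such that sum |y_j - y'_j|^p converges iff
   sum |T_j y_j - T_j y'_j|^q does.  Let N_n consecutive free coordinates range
   over lam_n F_n; the direct sum of the corresponding T_j is not a good
   embedding of F_n, so for some pair a, b in F_n the ratio of the two sums over
   the whole block is off by a factor 4^n.  A subset of the block with extremal
   average keeps this ratio while one of its two sums is at least 1 and the
   other at most of order 2^-n.  Summing over infinitely many n contradicts the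
   equivalence. *)
Require Import Defs.
From HB Require Import structures.
From mathcomp Require Import all_boot all_order all_algebra.
From mathcomp Require Import all_classical all_reals all_analysis.
From mathcomp Require Import zify ring lra.
Set Implicit Arguments.
Unset Strict Implicit.
Unset Printing Implicit Defensive.
Import Order.TTheory GRing.Theory Num.Theory.
Import numFieldNormedType.Exports.
Local Open Scope classical_set_scope.
Local Open Scope ring_scope.

Definition agree (k : nat) (w w' : nat -> nat) : Prop :=
  forall i, (i < k)%N -> w i = w' i.

Definition splice (n : nat) (u w : nat -> nat) : nat -> nat :=
  fun i => if (i < n)%N then u i else w i.

Definition string_open (U : set (nat -> nat)) : Prop :=
  forall w, U w -> exists k, forall w', agree k w w' -> U w'.

Definition string_dense (U : set (nat -> nat)) : Prop :=
  forall w k, exists2 w', agree k w w' & U w'.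

Definition comeager (C : set (nat -> nat)) : Prop :=
  exists D : nat -> set (nat -> nat),
    (forall i, string_open (D i) /\ string_dense (D i)) /\
    (forall w, (forall i, D i w) -> C w).

Lemma agree_refl k w : agree k w w. Proof. by []. Qed.

Lemma agree_trans k w1 w2 w3 : agree k w1 w2 -> agree k w2 w3 -> agree k w1 w3.
Proof. by move=> h h' i ik; rewrite h// h'. Qed.

Lemma agree_le k k' w w' : (k <= k')%N -> agree k' w w' -> agree k w w'.
Proof. by move=> kk h i ik; apply: h; exact: leq_trans kk. Qed.

Lemma agree_splice k n u w w' :
  agree k w w' -> agree k (splice n u w) (splice n u w').
Proof. by move=> h i ik; rewrite /splice; case: ifP => // _; exact: h. Qed.

Lemma comeager_sub C C' : comeager C -> C `<=` C' -> comeager C'.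
Proof. by move=> [D [oD DC]] CC'; exists D; split => // w Dw; exact/CC'/DC. Qed.

Lemma comeager_open_dense U : string_open U -> string_dense U -> comeager U.
Proof. by move=> oU dU; exists (fun=> U); split => // w; apply; exact: 0. Qed.

Lemma comeager_forall (I : countType) (C : I -> set (nat -> nat)) :
  (forall i, comeager (C i)) -> comeager [set w | forall i, C i w].
Proof.
move=> /choice[D hD].
exists (fun n => if unpickle n is Some (i, j) then D i j else setT).
split=> [n|w h i].
  case: unpickle => [[i j]|]; first by have [+ _] := hD i; apply.
  by split=> [w _|w k]; [exists 0 | exists w].
have [_] := hD i; apply => j.
by have := h (pickle (i, j)); rewrite pickleK.
Qed.

Lemma comeagerI C C' : comeager C -> comeager C' -> comeager (C `&` C').
Proof.
move=> hC hC'.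
apply: comeager_sub (@comeager_forall bool (fun b => if b then C else C') _) _.
  by case.
by move=> w h; split; [have := h true | have := h false].
Qed.

Lemma comeager_nonempty C w k :
  comeager C -> exists2 w', agree k w w' & C w'.
Proof.
move=> [D [oD DC]].
have step (ns : nat * ((nat -> nat) * nat)) : exists t : (nat -> nat) * nat,
    [/\ agree ns.2.2 ns.2.1 t.1, (ns.2.2 < t.2)%N &
     forall w', agree t.2 t.1 w' -> D ns.1 w'].
  case: ns => n [v m]; have [/(_ _) o d] := oD n.
  have [v' vv' Dv'] := d v m; have [k' hk'] := o _ Dv'.
  exists (v', maxn m.+1 k') => /=; split => //; first by rewrite leq_max leqnn.
  by move=> w' h; apply: hk'; apply: agree_le h; rewrite leq_maxr.
have [g hg] := choice step.
pose s := fix s n := if n is n'.+1 then g (n', s n') else (w, k).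
have s_lt n : ((s n).2 < (s n.+1).2)%N by case: (hg (n, s n)).
have s_ge n : (n <= (s n).2)%N.
  by elim: n => // n ih; exact: leq_ltn_trans (s_lt n).
have s_le m n : (m <= n)%N -> ((s m).2 <= (s n).2)%N.
  move=> /subnKC <-; elim: (n - m)%N => [|d ih]; first by rewrite addn0.
  by rewrite addnS; apply: leq_trans ih (ltnW _).
have s_agree m n : (m <= n)%N -> agree (s m).2 (s m).1 (s n).1.
  move=> /subnKC <-; elim: (n - m)%N => [|d ih]; first by rewrite addn0.
  rewrite addnS; apply: agree_trans ih _.
  apply: (@agree_le _ (s (m + d)%N).2); first exact/s_le/leq_addr.
  by case: (hg ((m + d)%N, s (m + d)%N)).
pose v i := (s i.+1).1 i.
have v_agree n : agree (s n).2 (s n).1 v.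
  move=> i hi; rewrite /v; have [ni|ni] := leqP n i.+1.
    exact: s_agree.
  by rewrite (s_agree _ _ (ltnW ni))//; exact: leq_trans (s_ge _).
exists v; first exact: (v_agree 0%N).
apply: DC => n; have [_ _] := hg (n, s n); apply; exact: (v_agree n.+1).
Qed.

Lemma open_dense_splice n u U : string_open U -> string_dense U ->
  string_open [set w | U (splice n u w)] /\
  string_dense [set w | U (splice n u w)].
Proof.
move=> oU dU; split=> [w /oU[k hk]|w k].
  by exists k => w' ww'; apply: hk; exact: agree_splice.
have [z hz Uz] := dU (splice n u w) (maxn n k).
exists (splice n w z) => [i ik|/=].
  rewrite /splice; case: ltnP => // ni; rewrite -hz ?leq_max ?ik ?orbT//.
  by rewrite /splice ltnNge ni.
have -> // : splice n u (splice n w z) = z.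
apply/funext => i; rewrite /splice; case: ltnP => // ni.
by rewrite -hz ?leq_max ?ni// /splice ni.
Qed.

Lemma comeager_splice n u C : comeager C -> comeager [set w | C (splice n u w)].
Proof.
move=> [D [oD DC]]; exists (fun i => [set w | D i (splice n u w)]).
split=> [i|w h]; last exact: DC.
by have [? ?] := oD i; exact: open_dense_splice.
Qed.

(** * The Baire property of Borel sets *)

(* Equivalent to the Baire property, and visibly stable under complement. *)
Definition generically_clopen (P : set (nat -> nat)) : Prop :=
  exists2 C, comeager C & forall w, C w ->
    exists k, forall w', C w' -> agree k w w' -> (P w <-> P w').

Lemma generically_clopen_open U : string_open U -> generically_clopen U.
Proof.
move=> oU.
pose V := [set w | exists k, (forall w', agree k w w' -> U w') \/
                             (forall w', agree k w w' -> ~ U w')].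
exists V.
  apply: comeager_open_dense => [w [k hk]|w k].
    exists k => w' ww'; exists k.
    by case: hk => hk; [left|right] => v h; apply: hk; exact: agree_trans h.
  have [[w' [ww' Uw']]|no] := pselect (exists w', agree k w w' /\ U w').
    by exists w' => //; have [k' hk'] := oU _ Uw'; exists k'; left.
  exists w => //; exists k; right => w' ww' Uw'.
  by apply: no; exists w'.
move=> w [k [hk|hk]]; exists k => w' _ ww'; split => h.
- exact: hk.
- exact/hk.
- by case: (hk w).
- by case: (hk w').
Qed.

Lemma generically_clopenC P : generically_clopen P -> generically_clopen (~` P).
Proof.
move=> [C cC hC]; exists C => // w /hC[k hk]; exists k => w' Cw' ww'.
by have [h1 h2] := hk _ Cw' ww'; split => h; [move=> /h2 /h|move=> /h1 /h].
Qed.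

Lemma generically_clopen_bigcup (P : (set (nat -> nat))^nat) :
  (forall n, generically_clopen (P n)) ->
  generically_clopen (\bigcup_n P n).
Proof.
move=> hP.
have /choice[C hC] n : exists C, comeager C /\ forall w, C w ->
    exists k, forall w', C w' -> agree k w w' -> (P n w <-> P n w').
  by case: (hP n) => C ? ?; exists C.
pose CC := [set w | forall n, C n w].
have cCC : comeager CC by apply: comeager_forall => n; case: (hC n).
pose Q := \bigcup_n P n.
pose V := [set w | exists k, (forall w', agree k w w' -> CC w' -> Q w') \/
                             (forall w', agree k w w' -> CC w' -> ~ Q w')].
have cV : comeager V.
  apply: comeager_open_dense => [w [k hk]|w k].
    exists k => w' ww'; exists k.
    by case: hk => hk; [left|right] => v h; apply: hk; exact: agree_trans h.
  have [[w' [ww' [Cw' [n _ Pw']]]]|no] :=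
      pselect (exists w', agree k w w' /\ CC w' /\ Q w').
    exists w' => //; have [_ /(_ w' (Cw' n))[k' hk']] := hC n.
    by exists k'; left => v wv Cv; exists n => //; apply/(hk' v (Cv n) wv).
  exists w => //; exists k; right => w' ww' Cw' Qw'.
  by apply: no; exists w'.
exists (CC `&` V); first exact: comeagerI.
move=> w [Cw [k [hk|hk]]]; exists k => w' [Cw' _] ww'; split => h.
- exact: hk.
- exact: hk.
- by case: (hk w).
- by case: (hk w').
Qed.

Lemma borel_generically_clopen (T : topologicalType) (g : (nat -> nat) -> T) :
  (forall O : set T, open O -> string_open (g @^-1` O)) ->
  forall A : set T, borel_set A -> generically_clopen (g @^-1` A).
Proof.
move=> gO; apply: smallest_sub => [|O oO]; last first.
  by apply: generically_clopen_open; exact: gO.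
split => /=.
- by rewrite preimage_set0; apply: generically_clopen_open.
- by move=> A gA; rewrite setTD preimage_setC; exact: generically_clopenC.
- move=> F hF; rewrite preimage_bigcup; exact: generically_clopen_bigcup.
Qed.


Lemma map_string_open (V : uniformType) (f : nat -> V) (O : set {ptws nat -> V}) :
  open O ->
  string_open ((fun w : nat -> nat => (f \o w : {ptws nat -> V})) @^-1` O).
Proof.
move=> oO w Ow; apply: contrapT => no.
have /choice[v hv] k : exists v, agree k w v /\ ~ O (f \o v : {ptws nat -> V}).
  apply: contrapT => nov; apply: no; exists k => w' ww'.
  by apply: contrapT => nO; apply: nov; exists w'.
have vw : {ptws, (fun k => f \o v k) @ \oo --> (f \o w)}.
  apply/pointwise_cvgP => i; apply: cvg_near_cst.
  exists i.+1 => // k /= ik; congr f; apply/esym.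
  by have [+ _] := hv k; apply.
have nO : nbhs (f \o w : {ptws nat -> V}) O by exact: open_nbhs_nbhs.
have [k _ /(_ k (leqnn k))] := vw _ nO.
by have [_] := hv k.
Qed.

Lemma dense_seq (R : realType) (V : normedModType R) : separable_space V ->
  exists d : nat -> V, forall v e, 0 < e -> exists i, `|v - d i| < e.
Proof.
move=> [D cD dD].
have [d hd] : exists d : nat -> V, forall x, D x -> exists i, d i = x.
  case/pfcard_geP: cD => [->|[d]]; first by exists (fun=> 0).
  by exists d => x Dx; have [i _ <-] := 'surj_d Dx; exists i.
exists d => v e e0.
have [||x [/= Bx Dx]] := dD (ball v e).
- by exists v; exact: ballxx.
- exact: ball_open.
have [i ix] := hd _ Dx; exists i; rewrite ix.
by move: Bx; rewrite -ball_normE.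
Qed.

Definition generically_continuous (R : realType) (Y : normedModType R)
    (C : set (nat -> nat)) (phi : (nat -> nat) -> nat -> Y) : Prop :=
  forall w m e, C w -> 0 < e ->
    exists k, forall w', C w' -> agree k w w' -> `|phi w m - phi w' m| < e.

Lemma borel_generically_continuous (R : realType) (X Y : completeNormedModType R)
    (f : nat -> X) (theta : {ptws nat -> X} -> {ptws nat -> Y}) :
  separable_space Y -> borel_map theta ->
  exists2 C, comeager C & generically_continuous C (fun w => theta (f \o w)).
Proof.
move=> /dense_seq[d hd] btheta.
pose P (i : nat * nat * nat) :=
  [set w : nat -> nat | `|theta (f \o w) i.1.2 - d i.1.1| < i.2.+1%:R^-1].
have /choice[C hC] i : exists C, comeager C /\ forall w, C w ->
    exists k, forall w', C w' -> agree k w w' -> (P i w <-> P i w').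
  suff [C] : generically_clopen (P i) by exists C.
  pose O := (fun y : {ptws nat -> Y} => y i.1.2) @^-1`
    (ball (d i.1.1) i.2.+1%:R^-1).
  have oO : open O.
    apply: open_comp; last exact: ball_open.
    by move=> y _; exact: proj_continuous.
  have -> : P i = (fun w : nat -> nat => f \o w : {ptws nat -> X}) @^-1`
      (theta @^-1` O).
    by apply/funext => w; rewrite /P /O /preimage /= -ball_normE /= distrC.
  apply: borel_generically_clopen; first exact: map_string_open.
  by apply: btheta; apply: sub_sigma_algebra.
exists [set w | forall i, C i w].
  by apply: comeager_forall => i; case: (hC i).
move=> w m e Cw e0.
have [n hn] : exists n, n.+1%:R^-1 < e / 2.
  have := @near_infty_natSinv_lt R (PosNum (divr_gt0 e0 (ltr0Sn R 1))).
  by case=> n _ /(_ n (leqnn n)); exists n.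
have [i hi] := hd (theta (f \o w) m) n.+1%:R^-1 (ltac:(by rewrite invr_gt0)).
have [_ /(_ w (Cw _))[k hk]] := hC (i, m, n).
exists k => w' Cw' ww'.
have : P (i, m, n) w' by apply/(hk _ (Cw' _) ww').
rewrite /P /= in hi *.
move=> hi'; rewrite (splitr e).
apply: le_lt_trans (ler_distD (d i) _ _) _.
by apply: ltrD; [apply: lt_trans hi _ | rewrite distrC; apply: lt_trans hi' _].
Qed.

(** * Bounded partial sums *)

Definition sum_bounded (R : realType) (u : nat -> R) : Prop :=
  exists M, forall n, \sum_(0 <= i < n) u i <= M.

Section sum_bounded.
Context {R : realType}.
Implicit Types u v : nat -> R.

Lemma sum_bounded_le u v :
  (forall n, u n <= v n) -> sum_bounded v -> sum_bounded u.
Proof.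
by move=> uv [M hM]; exists M => n; apply: le_trans (hM n); apply: ler_sum.
Qed.

Lemma sum_bounded_lin (c : R) u v : 0 <= c ->
  sum_bounded u -> sum_bounded v -> sum_bounded (fun n => c * (u n + v n)).
Proof.
move=> c0 [M hM] [N hN]; exists (c * (M + N)) => n.
by rewrite -mulr_sumr big_split ler_wpM2l// lerD.
Qed.

Lemma sum_tail_le u (l l' L : nat) : (forall n, 0 <= u n) -> (l <= l')%N ->
  \sum_(l' <= i < L) u i <= \sum_(l <= i < L) u i.
Proof.
move=> u0 ll'; have [Ll'|l'L] := leqP L l'.
  by rewrite [leLHS]big_geq// sumr_ge0.
by rewrite [leRHS](@big_cat_nat _ _ _ l')//= ?(ltnW l'L)// lerDr sumr_ge0.
Qed.

Lemma sum_head_le u (L L' : nat) : (forall n, 0 <= u n) -> (L <= L')%N ->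
  \sum_(0 <= i < L) u i <= \sum_(0 <= i < L') u i.
Proof.
by move=> u0 LL'; rewrite [leRHS](@big_cat_nat _ _ _ L)//= lerDl sumr_ge0.
Qed.

Lemma sum_bounded_tail u e : (forall n, 0 <= u n) -> sum_bounded u -> 0 < e ->
  exists l, forall L, \sum_(l <= i < L) u i <= e.
Proof.
move=> u0 [M hM] e0; pose E := [set \sum_(0 <= i < n) u i | n in [set: nat]].
have supE : has_sup E.
  by split; [exists (\sum_(0 <= i < 0) u i); exists 0%N|exists M => _ [n _ <-]].
have [_ [l _ <-] hl] := sup_adherent e0 supE.
exists l => L; have [Ll|/ltnW lL] := leqP L l; first by rewrite big_geq// ltW.
have : \sum_(0 <= i < L) u i <= sup E.
  by apply: ub_le_sup; [case: supE | exists L].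
rewrite (@big_cat_nat _ _ _ l)//=; move: hl; set a := \sum_(0 <= i < l) _.
set b := \sum_(l <= i < L) _; move: (sup E) => s; lra.
Qed.

Lemma strict_incr_ge (P : nat -> nat) n :
  (forall n, (P n < P n.+1)%N) -> (n <= P n)%N.
Proof. by move=> hP; elim: n => // n ih; exact: leq_ltn_trans (hP n). Qed.

Lemma strict_incr_le (P : nat -> nat) m n :
  (forall n, (P n < P n.+1)%N) -> (m <= n)%N -> (P m <= P n)%N.
Proof.
move=> hP /subnKC <-; elim: (n - m)%N => [|d ih]; first by rewrite addn0.
by rewrite addnS; apply: leq_trans ih (ltnW _).
Qed.

Lemma strict_incr_block (P : nat -> nat) : P 0%N = 0%N ->
  (forall n, (P n < P n.+1)%N) -> forall j, exists n, (P n <= j < P n.+1)%N.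
Proof.
move=> P0 hP; elim=> [|j [n /andP[h1 h2]]].
  by exists 0%N; have := hP 0%N; rewrite P0.
move: h2; rewrite leq_eqVlt => /orP[/eqP h2|h2]; last first.
  by exists n; rewrite h2 ltnW.
by exists n.+1; rewrite -h2 leqnn /= h2 hP.
Qed.

Lemma strict_incr_block_uniq (P : nat -> nat) m n j :
  (forall n, (P n < P n.+1)%N) ->
  (P m <= j < P m.+1)%N -> (P n <= j < P n.+1)%N -> m = n.
Proof.
move=> hP /andP[a b] /andP[c d]; apply/eqP; rewrite eqn_leq; apply/andP; split.
  rewrite leqNgt; apply/negP => /(strict_incr_le hP) h; lia.
rewrite leqNgt; apply/negP => /(strict_incr_le hP) h; lia.
Qed.

Lemma sum_blocks (P : nat -> nat) u n m : (forall n, (P n < P n.+1)%N) ->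
  (m <= n)%N ->
  \sum_(m <= j < n) \sum_(P j <= i < P j.+1) u i = \sum_(P m <= i < P n) u i.
Proof.
move=> hP; elim: n => [|n ih]; first by rewrite leqn0 => /eqP ->; rewrite !big_geq.
rewrite leq_eqVlt => /orP[/eqP ->|]; first by rewrite !big_geq.
rewrite ltnS => mn; rewrite big_nat_recr//= ih//.
by rewrite -big_cat_nat//=; [exact: strict_incr_le | exact: ltnW].
Qed.

Lemma sum_bounded_blocks (P : nat -> nat) u : (forall n, 0 <= u n) ->
  P 0%N = 0%N -> (forall n, (P n < P n.+1)%N) ->
  sum_bounded u <-> sum_bounded (fun n => \sum_(P n <= i < P n.+1) u i).
Proof.
move=> u0 P0 hP; split=> -[M hM]; exists M => n.
  by rewrite sum_blocks// P0.
apply: le_trans (hM n); rewrite sum_blocks// P0.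
exact/sum_head_le/strict_incr_ge.
Qed.

Lemma sum_bounded_geometric : sum_bounded (fun n => 2^-1 ^+ n : R).
Proof.
exists 2 => n; suff -> : \sum_(0 <= i < n) (2^-1 ^+ i : R) = 2 - 2 * 2^-1 ^+ n.
  by rewrite gerBl mulr_ge0// exprn_ge0// invr_ge0.
elim: n => [|n ih]; first by rewrite big_geq// expr0; ring.
by rewrite big_nat_recr//= ih exprS; field.
Qed.

Lemma nneseries_sum_bounded u : (forall n, 0 <= u n) ->
  (\sum_(0 <= n <oo) (u n)%:E < +oo)%E <-> sum_bounded u.
Proof.
move=> u0; have u0' n : (0 <= n)%N -> xpredT n -> (0 <= (u n)%:E)%E.
  by rewrite lee_fin.
split=> [h|[M hM]].
  exists (fine (\sum_(0 <= n <oo) (u n)%:E)%E) => n.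
  rewrite -lee_fin fineK; last by rewrite ge0_fin_numE// nneseries_ge0.
  by rewrite -sumEFin; exact: nneseries_lim_ge.
apply: (@le_lt_trans _ _ M%:E); last exact: ltry.
apply: lime_le; first exact: is_cvg_nneseries.
by near=> n; rewrite sumEFin lee_fin.
Unshelve. all: by end_near. Qed.

End sum_bounded.

Section powers.
Context {R : realType} {V : normedModType R}.

Lemma powR_normD (q : R) (a b : V) : 0 <= q ->
  `|a + b| `^ q <= 2 `^ q * (`|a| `^ q + `|b| `^ q).
Proof.
move=> q0; wlog ab : a b / `|a| <= `|b|.
  move=> h; have [|/ltW] := leP `|a| `|b|; first exact: h.
  by move=> /h; rewrite addrC (addrC (`|b| `^ q)).
apply: (@le_trans _ _ ((2 * `|b|) `^ q)).
  apply: ge0_ler_powR; rewrite ?nnegrE ?mulr_ge0//.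
  by apply: le_trans (ler_normD _ _) _; rewrite mulr2n mulrDl mul1r lerD2r.
by rewrite powRM// ler_wpM2l ?powR_ge0// lerDr powR_ge0.
Qed.

Lemma powR_small (q e : R) (L : nat) : 0 < q -> 0 < e ->
  exists2 d, 0 < d & d `^ q * L%:R <= e.
Proof.
move=> q0 e0; have L0 : (0 : R) < L.+1%:R by [].
exists ((e / L.+1%:R) `^ q^-1); first by rewrite powR_gt0// divr_gt0.
rewrite -powRrM mulVf ?gt_eqF// powRr1 ?divr_ge0 ?(ltW e0)//.
by rewrite mulrAC ler_pdivrMr// ler_wpM2l ?(ltW e0)// ler_nat.
Qed.

End powers.

Lemma E_relE (R : realType) (X : normedModType R) (p : R) (x y : {ptws nat -> X}) :
  E_rel p x y <-> sum_bounded (fun n => `|x n - y n| `^ p).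
Proof. by rewrite /E_rel nneseries_sum_bounded// => n; exact: powR_ge0. Qed.

(** * Reduction to a coordinatewise map *)

Lemma agree_spliceK n k u w z : (n <= k)%N -> agree k (splice n u w) z ->
  splice n u (splice n w z) = z /\ agree k w (splice n w z).
Proof.
move=> nk h; split=> [|i ik].
  apply/funext => i; rewrite /splice; case: ltnP => // ni.
  by rewrite -h /splice ?ni//; exact: leq_trans nk.
rewrite /splice; case: ltnP => // ni.
by rewrite -h// /splice ltnNge ni.
Qed.

Lemma extend_all (A : eqType) (s : seq A)
    (Q : A -> (nat -> nat) -> nat -> nat -> Prop) :
  (forall a w k l w' k' l', Q a w k l -> agree k w w' -> (k <= k')%N ->
    (l <= l')%N -> Q a w' k' l') ->
  (forall a w k l, exists w' k' l',
    [/\ agree k w w', (k <= k')%N, (l <= l')%N & Q a w' k' l']) ->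
  forall w k l, exists w' k' l',
    [/\ agree k w w', (k <= k')%N, (l <= l')%N & forall a, a \in s -> Q a w' k' l'].
Proof.
move=> mQ eQ; elim: s => [|a s ih] w k l.
  by exists w, k, l; split.
have [w1 [k1 [l1 [ww1 kk1 ll1 hs]]]] := ih w k l.
have [w2 [k2 [l2 [ww2 kk2 ll2 ha]]]] := eQ a w1 k1 l1.
exists w2, k2, l2; split.
- by apply: agree_trans ww1 _; exact: agree_le ww2.
- exact: leq_trans kk2.
- exact: leq_trans ll2.
- move=> b; rewrite inE => /predU1P[-> //|/hs h]; exact: mQ h _ _ _.
Qed.

Section coordinatewise.
Context {R : realType} {Y : normedModType R} (q : R) (q_ge1 : 1 <= q).
Context (D : nat -> set (nat -> nat)) (phi : (nat -> nat) -> nat -> Y).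
Hypothesis openD : forall i, string_open (D i).
Hypothesis denseD : forall i, string_dense (D i).
Let C := [set w | forall i, D i w].
Hypothesis phi_cont : generically_continuous C phi.
Let dist x y m := `|phi x m - phi y m| `^ q.
Hypothesis phi_tail : forall x y n,
  (forall i, (n <= i)%N -> x i = y i) -> sum_bounded (dist x y).

Let q_gt0 : 0 < q. Proof. exact: lt_le_trans q_ge1. Qed.

Let dist_ge0 x y m : 0 <= dist x y m. Proof. exact: powR_ge0. Qed.

Let distxx x m : dist x x m = 0.
Proof. by rewrite /dist subrr normr0 powR0// gt_eqF. Qed.

Let comeagerC : comeager C.
Proof. by exists D; split. Qed.

Lemma generically_continuous_finite w L e : C w -> 0 < e ->
  exists k, forall w', C w' -> agree k w w' ->
    forall m, (m < L)%N -> `|phi w m - phi w' m| < e.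
Proof.
move=> Cw e0; elim: L => [|L [k hk]]; first by exists 0%N.
have [k' hk'] := phi_cont L Cw e0.
exists (maxn k k') => w' Cw' ww' m; rewrite ltnS leq_eqVlt => /predU1P[->|mL].
  by apply: hk' => //; apply: agree_le ww'; rewrite leq_maxr.
by apply: hk => //; apply: agree_le ww'; rewrite leq_maxl.
Qed.

Definition tails_small n u v e w k l := forall t, agree k w t ->
  C (splice n u t) -> C (splice n v t) ->
  forall L, \sum_(l <= m < L) dist (splice n u t) (splice n v t) m <= e.

(* Otherwise the set of t whose l-tail is large for every l would be comeager in
   a nonempty open set, whereas every tail sequence is summable. *)
Lemma tails_small_dense n u v e w k l : 0 < e -> exists w' k' l',
  [/\ agree k w w', (k <= k')%N, (l <= l')%N & tails_small n u v e w' k' l'].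
Proof.
move=> e0; apply: contrapT => no.
have {}no w' k' l' : agree k w w' -> (k <= k')%N -> (l <= l')%N ->
    exists t, [/\ agree k' w' t, C (splice n u t), C (splice n v t) &
      exists L, e < \sum_(l' <= m < L) dist (splice n u t) (splice n v t) m].
  move=> ww' kk' ll'; apply: contrapT => no'; apply: no; exists w', k', l'.
  split=> // t w't Cu Cv L; rewrite leNgt; apply/negP => h; apply: no'.
  by exists t; split=> //; exists L.
pose e' := e / (2 * 2 `^ q).
have p2 : 0 < 2 `^ q :> R by exact: powR_gt0.
have e'0 : 0 < e' by rewrite divr_gt0// mulr_gt0.
pose O l' := [set t | exists k2, forall t', agree k2 t t' ->
   agree k w t' -> C (splice n u t') -> C (splice n v t') -> exists L,
   e' < \sum_((l + l')%N <= m < L) dist (splice n u t') (splice n v t') m].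
have oO l' : string_open (O l').
  move=> t [k2 hk2]; exists k2 => t' tt'; exists k2 => t2 h; apply: hk2.
  exact: agree_trans h.
have dO l' : string_dense (O l').
  move=> w1 k1; have [[w2 [w12 ww2]]|now] :=
      pselect (exists w2, agree k1 w1 w2 /\ agree k w w2); last first.
    exists w1 => //; exists k1 => t' wt' kt'; exfalso.
    by apply: now; exists t'.
  have [t [w2t Cu Cv [L hL]]] := no w2 (maxn k k1) (l + l')%N ww2
    (leq_maxl _ _) (leq_addr _ _).
  exists t.
    by apply: agree_trans w12 _; apply: agree_le w2t; rewrite leq_maxr.
  have [d d0 hd] := @powR_small R q (e / (2 * 2 `^ q)) L q_gt0 e'0.
  have d20 : 0 < d / 2 by rewrite divr_gt0.
  have [ku hu] := generically_continuous_finite L Cu d20.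
  have [kv hv] := generically_continuous_finite L Cv d20.
  exists (maxn ku kv) => t' tt' _ Cu' Cv'; exists L.
  have {}hu m : (m < L)%N -> _ := hu _ Cu' (agree_splice n u
    (agree_le (leq_maxl _ _) tt')) m.
  have {}hv m : (m < L)%N -> _ := hv _ Cv' (agree_splice n v
    (agree_le (leq_maxr _ _) tt')) m.
  set s' := \sum_(_ <= _ < _) _.
  have : \sum_(l + l' <= m < L) dist (splice n u t) (splice n v t) m <=
      2 `^ q * (s' + d `^ q * L%:R).
    apply: (@le_trans _ _ (\sum_(l + l' <= m < L) (2 `^ q *
        (dist (splice n u t') (splice n v t') m + d `^ q)))).
      apply: ler_sum_nat => m /andP[_ mL].
      set a := phi (splice n u t) m; set b := phi (splice n v t) m.
      set a' := phi (splice n u t') m; set b' := phi (splice n v t') m.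
      rewrite /dist -/a -/b -/a' -/b'.
      have -> : a - b = (a' - b') + ((a - a') - (b - b')).
        by rewrite (opprD b) (addrACA a) -opprD [RHS]addrC subrK.
      apply: le_trans (powR_normD _ _ (ltW q_gt0)) _.
      rewrite ler_wpM2l ?(ltW p2)// lerD2l.
      apply: ge0_ler_powR; rewrite ?nnegrE ?(ltW q_gt0) ?(ltW d0)//.
      apply: le_trans (ler_normB _ _) _; rewrite [leRHS]splitr.
      by apply: lerD; apply/ltW; [exact: hu|exact: hv].
    rewrite -mulr_sumr ler_wpM2l ?(ltW p2)// big_split /= lerD2l.
    rewrite sumr_const_nat -[leLHS]mulr_natr ler_wpM2l ?powR_ge0// ler_nat.
    exact: leq_subr.
  move=> /(lt_le_trans hL) h.
  have {}h : e < 2 `^ q * (s' + e').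
    by apply: lt_le_trans h _; rewrite ler_wpM2l ?(ltW p2)// lerD2l.
  have ee : e = 2 `^ q * (e' + e').
    by rewrite /e'; field; rewrite gt_eqF.
  by move: h; rewrite [X in X < _]ee ltr_pM2l// ltrD2r.
have [t wt [[Cu Cv] Ot]] : exists2 t, agree k w t &
    ([set t | C (splice n u t)] `&` [set t | C (splice n v t)] `&`
     [set t | forall l', O l' t]) t.
  apply: comeager_nonempty; apply: comeagerI.
    by apply: comeagerI; exact: comeager_splice.
  by apply: comeager_forall => l'; exact: comeager_open_dense.
have /sum_bounded_tail : sum_bounded (dist (splice n u t) (splice n v t)).
  by apply: (@phi_tail _ _ n) => i ni; rewrite /splice ltnNge ni.
move=> /(_ e' (dist_ge0 _ _) e'0)[l' hl'].
have [k2 /(_ t (@agree_refl k2 t) wt Cu Cv)[L]] := Ot l'.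
apply/negP; rewrite -leNgt; apply: le_trans (hl' L).
exact/sum_tail_le/leq_addl.
Qed.

Lemma tails_small_mono n u v e w k l w' k' l' : tails_small n u v e w k l ->
  agree k w w' -> (k <= k')%N -> (l <= l')%N -> tails_small n u v e w' k' l'.
Proof.
move=> h ww' kk' ll' t w't Cu Cv L; apply: le_trans (h t _ Cu Cv L).
  exact: sum_tail_le.
by apply: agree_trans ww' _; exact: agree_le w't.
Qed.

Definition heads_small n u e l w k := forall t t', agree k w t ->
  agree k w t' -> C (splice n u t) -> C (splice n u t') ->
  \sum_(0 <= m < l) dist (splice n u t) (splice n u t') m <= e.

Lemma heads_small_dense n u e l w k : 0 < e -> exists w' k',
  [/\ agree k w w', (k <= k')%N & heads_small n u e l w' k'].
Proof.
move=> e0; have [t0 wt0 Ct0] := comeager_nonempty w k (comeager_splice n u comeagerC).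
have [d d0 hd] := @powR_small R q e l q_gt0 e0.
have d20 : 0 < d / 2 by rewrite divr_gt0.
have [k' hk'] := generically_continuous_finite l Ct0 d20.
exists t0, (maxn k k'); split=> //; first by rewrite leq_maxl.
move=> t t' tt tt' Ct Ct'; apply: le_trans hd.
rewrite -(subn0 l) mulr_natr -sumr_const_nat subn0.
apply: ler_sum_nat => m /andP[_ ml].
apply: ge0_ler_powR; rewrite ?nnegrE ?(ltW q_gt0) ?(ltW d0)//.
apply: le_trans (ler_distD (phi (splice n u t0) m) _ _) _.
rewrite [leRHS]splitr; apply: lerD; apply/ltW.
  rewrite distrC; apply: hk' => //; apply: agree_splice.
  by apply: agree_le tt; rewrite leq_maxr.
apply: hk' => //; apply: agree_splice.
by apply: agree_le tt'; rewrite leq_maxr.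
Qed.

Definition controlled j e (S : seq (nat -> nat)) k l :=
  [/\ forall u v z z', u \in S -> v \in S -> agree k u z -> agree k v z' ->
        (forall i, (k <= i)%N -> z i = z' i) -> C z -> C z' ->
        forall L, \sum_(l <= m < L) dist z z' m <= e,
      forall u z z', u \in S -> agree k u z -> agree k u z' -> C z -> C z' ->
        \sum_(0 <= m < l) dist z z' m <= e &
      forall u z, u \in S -> agree k u z -> forall i, (i <= j)%N -> D i z].

Lemma controlled_extension S n j e l : 0 < e -> exists w k l',
  [/\ (n < k)%N, (l < l')%N & controlled j e [seq splice n u w | u <- S] k l'].
Proof.
move=> e0.
have [w1 [k1 [l1 [_ k1n l1l tails]]]] := @extend_all _
  [seq (u, v) | u <- S, v <- S] (fun a => tails_small n a.1 a.2 e)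
  (fun a => @tails_small_mono n a.1 a.2 e)
  (fun a w k l => @tails_small_dense n a.1 a.2 e w k l e0) (fun=> 0%N) n.+1 l.+1.
have [||w2 [k2 [_ [w12 k12 _ heads]]]] := @extend_all _ S
    (fun u w k _ => heads_small n u e l1 w k) _ _ w1 k1 0%N.
- move=> u w k _ w' k' _ h ww' kk' _ t t' h1 h2.
  by apply: h; apply: agree_trans ww' _; apply: agree_le kk' _.
- move=> u w k l2; have [w' [k' [? ? ?]]] := @heads_small_dense n u e l1 w k e0.
  by exists w', k', l2; split.
have [||w3 [k3 [_ [w23 k23 _ generic]]]] := @extend_all _
    [seq (u, i) | u <- S, i <- iota 0 j.+1]
    (fun a w k _ => forall t, agree k w t -> D a.2 (splice n a.1 t)) _ _ w2 k2 0%N.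
- move=> a w k _ w' k' _ h ww' kk' _ t h1.
  by apply: h; apply: agree_trans ww' _; apply: agree_le kk' _.
- move=> [u i] w k l2 /=.
  have [oS dS] := open_dense_splice n u (@openD i) (@denseD i).
  have [w' ww' Dw'] := dS w k; have [k' hk'] := oS _ Dw'.
  exists w', (maxn k k'), l2; split=> //; first by rewrite leq_maxl.
  by move=> t h; apply: hk'; apply: agree_le h; rewrite leq_maxr.
have nk3 : (n < k3)%N by exact: leq_trans (leq_trans k1n k12) k23.
exists w3, k3, l1; split=> //; split.
- move=> _ _ z z' /mapP[u uS ->] /mapP[v vS ->] uz vz' zz' Cz Cz'.
  have [ez w3z] := agree_spliceK (ltnW nk3) uz.
  have [ez' w3z'] := agree_spliceK (ltnW nk3) vz'.
  have ee : splice n w3 z' = splice n w3 z.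
    apply/funext => i; have [ik|ik] := ltnP i k3; first by rewrite -w3z// -w3z'.
    by rewrite /splice zz'.
  rewrite -ez -ez' ee; rewrite -ez' ee in Cz'; rewrite -ez in Cz.
  apply: (tails (u, v)) => //; first by apply/allpairsP; exists (u, v).
  apply: agree_trans w12 (agree_trans (agree_le k12 w23) _).
  by apply: agree_le w3z; exact: leq_trans k23.
- move=> _ z z' /mapP[u uS ->] uz uz' Cz Cz'.
  have [ez w3z] := agree_spliceK (ltnW nk3) uz.
  have [ez' w3z'] := agree_spliceK (ltnW nk3) uz'.
  rewrite -ez -ez'; rewrite -ez in Cz; rewrite -ez' in Cz'.
  by apply: (heads u) => //; apply: agree_trans w23 _;
    [apply: agree_le w3z | apply: agree_le w3z'].
- move=> _ z /mapP[u uS ->] uz i ij.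
  have [ez w3z] := agree_spliceK (ltnW nk3) uz.
  rewrite -ez; apply: (generic (u, i)) => //.
  by apply/allpairsP; exists (u, i); rewrite mem_iota.
Qed.

Theorem coordinatewise_approximation (c : nat -> seq nat) (y0 : nat -> nat) :
  (forall j, y0 j \in c j) ->
  exists (k l : nat -> nat) (x : (nat -> nat) -> nat -> nat)
         (T : nat -> nat -> nat -> Y),
    [/\ k 0%N = 0%N /\ forall j, (k j < k j.+1)%N,
        l 0%N = 0%N /\ forall j, (l j < l j.+1)%N,
        forall y j, x y (k j) = y j,
        forall y y' i, (forall j, i <> k j) -> x y i = x y' i &
        forall y, (forall j, y j \in c j) -> sum_bounded (fun j =>
          \sum_(l j <= m < l j.+1) `|phi (x y) m - T j (y j) m| `^ q)].
Proof.
move=> y0c.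
pose upd (k a : nat) (u : nat -> nat) : nat -> nat :=
  fun i => if i == k then a else u i.
pose next (w : nat -> nat) j (S : seq (nat -> nat)) k :=
  [seq splice k.+1 u w | u <- [seq upd k a u | u <- S, a <- c j]].
pose state : Type := (nat -> nat) * seq (nat -> nat) * nat * nat.
have step (js : nat * state) : exists s : state,
    let: (j, (_, A, k, l)) := js in let: (w', A', k', l') := s in
    [/\ A' = next w' j A k, (k < k')%N, (l < l')%N &
     controlled j (2^-1 ^+ j) A' k' l'].
  case: js => j [[[w A] k] l].
  have [|w' [k' [l' [kk' ll' h]]]] := @controlled_extension
    [seq upd k a u | u <- A, a <- c j] k.+1 j (2^-1 ^+ j) l.
    by rewrite exprn_gt0// invr_gt0.
  by exists (w', next w' j A k, k', l'); split=> //; exact: ltnW.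
have [g hg] := choice step.
pose st := fix st j : state :=
  if j is j'.+1 then g (j', st j') else (fun=> 0%N, [:: fun=> 0%N], 0%N, 0%N).
pose w j := (st j).1.1.1; pose S j := (st j).1.1.2.
pose k j := (st j).1.2; pose l j := (st j).2.
have hst j : [/\ S j.+1 = next (w j.+1) j (S j) (k j), (k j < k j.+1)%N,
    (l j < l j.+1)%N & controlled j (2^-1 ^+ j) (S j.+1) (k j.+1) (l j.+1)].
  have := hg (j, st j); rewrite /S /w /k /l /=.
  by case: (st j) => [[[? ?] ?] ?] /=; case: (g _) => [[[? ?] ?] ?].
have kS j : (k j < k j.+1)%N by case: (hst j).
have lS j : (l j < l j.+1)%N by case: (hst j).
pose hist := fix hist (y : nat -> nat) j : nat -> nat := if j is j'.+1
  then splice (k j').+1 (upd (k j') (y j') (hist y j')) (w j) else (fun=> 0%N).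
have histS y j : (forall j, y j \in c j) -> hist y j \in S j.
  move=> yc; elim: j => [|j ih]; first by rewrite /S /= inE.
  have [-> _ _ _] := hst j; rewrite /next; apply/mapP.
  refine (ex_intro2 _ _ (upd (k j) (y j) (hist y j)) _ erefl).
  by apply/allpairsP; exists (hist y j, y j); split => //; exact: yc.
have hist_eq y y' i J : (forall j, k j = i -> y j = y' j) ->
    hist y J i = hist y' J i.
  move=> yy'; elim: J => //= J ih; rewrite /splice; case: ifP => // _.
  by rewrite /upd; case: eqP => // iJ; exact: yy'.
have hist_agree y j J : (j <= J)%N -> agree (k j) (hist y j) (hist y J).
  move=> /subnKC <-; elim: (J - j)%N => [|d ih]; first by rewrite addn0.
  rewrite addnS; apply: agree_trans ih _ => i ij /=.
  have ikd : (i < k (j + d)%N)%N.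
    by apply: leq_trans ij _; apply: strict_incr_le => //; exact: leq_addr.
  by rewrite /splice /upd ltnS (ltnW ikd) ltn_eqF.
pose x y i := hist y i.+1 i.
have x_agree y j : agree (k j) (hist y j) (x y).
  move=> i ij; rewrite /x; have [ji|ji] := leqP j i.+1; first exact: hist_agree.
  rewrite (hist_agree y _ _ (ltnW ji))//.
  by apply: leq_trans (strict_incr_ge _ kS).
have xC y : (forall j, y j \in c j) -> C (x y).
  move=> yc i; have [_ _ _ [_ _ h]] := hst i.
  by apply: (h (hist y i.+1)) => //; exact: histS.
exists k, l, x, (fun j a => phi (x (upd j a y0))).
split=> //.
- move=> y j; rewrite -(x_agree y j.+1)//= /splice ltnSn /upd eqxx.
  by [].
- by move=> y y' i ik; apply: hist_eq => j kj; case: (ik j).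
move=> y yc.
have bnd j : \sum_(l j <= m < l j.+1)
    `|phi (x y) m - phi (x (upd j (y j) y0)) m| `^ q <=
    2 `^ q * (2^-1 ^+ j + 2 * 2^-1 ^+ j).
  (* From x y to x z only free coordinates after the j-th change, which moves
     the outputs below l j.+1 little; from x z to x z' only those before the
     j-th change, which moves the outputs from l j on little. *)
  pose z i := if (i <= j)%N then y i else y0 i.
  pose z' := upd j (y j) y0.
  have zc i : z i \in c i by rewrite /z; case: ifP.
  have z'c i : z' i \in c i by rewrite /z' /upd; case: eqP => // ->.
  apply: (@le_trans _ _ (\sum_(l j <= m < l j.+1)
      2 `^ q * (dist (x y) (x z) m + dist (x z) (x z') m))).
    apply: ler_sum => m _.
    rewrite -[phi (x y) m](subrK (phi (x z) m)) -addrA.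
    exact: powR_normD (ltW q_gt0).
  rewrite -mulr_sumr ler_wpM2l ?powR_ge0// big_split; apply: lerD => /=.
    have [_ _ _ [_ h _]] := hst j.
    apply: le_trans (h (hist y j.+1) (x y) (x z) _ _ _ _ _).
    - exact: sum_tail_le.
    - exact: histS.
    - exact: x_agree.
    - apply: agree_trans (x_agree z j.+1) => i ij; apply: hist_eq => J kJ.
      rewrite /z leqNgt; case: ltnP => // jJ.
      have := strict_incr_le kS jJ; lia.
    - exact: xC.
    - exact: xC.
  case: j @z @z' zc z'c => [|j] z z' zc z'c.
    have -> : z = z' by apply/funext; case.
    by rewrite big1 ?mulr_ge0 ?exprn_ge0 ?invr_ge0.
  have [_ _ _ [h _ _]] := hst j.
  rewrite exprS mulrA divff// mul1r.
  apply: (h (hist z j.+1) (hist z' j.+1)).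
  - exact: histS.
  - exact: histS.
  - exact: x_agree.
  - exact: x_agree.
  - move=> i ki; apply: hist_eq => J kJ.
    have jJ : (j < J)%N.
      rewrite ltnNge; apply/negP => Jj; have := strict_incr_le kS Jj.
      have := kS j; lia.
    rewrite /z /z' /upd; case: (ltngtP J j.+1) => // [|-> //].
    by rewrite ltnNge jJ.
  - exact: xC.
  - exact: xC.
apply: sum_bounded_le bnd _.
have g2 := @sum_bounded_geometric R.
apply: sum_bounded_lin; rewrite ?powR_ge0//.
apply: sum_bounded_le (sum_bounded_lin ler01 g2 g2) => n; lra.
Qed.

End coordinatewise.

Lemma sum_bounded_eventually_lt1 (R : realType) (u : nat -> R) :
  (forall n, 0 <= u n) -> sum_bounded u ->
  exists n0, forall n, (n0 <= n)%N -> u n < 1.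
Proof.
move=> u0 bu; have h2 : 0 < 2^-1 :> R by rewrite invr_gt0.
have [l hl] := sum_bounded_tail u0 bu h2.
exists l => n ln; have := hl n.+1; rewrite big_nat_recr//= => h.
have : 0 <= \sum_(l <= i < n) u i by exact: sumr_ge0.
lra.
Qed.

Lemma sum_bounded_powRD (R : realType) (V : normedModType R) (q : R)
    (a b : nat -> V) : 0 <= q ->
  sum_bounded (fun m => `|a m| `^ q) -> sum_bounded (fun m => `|b m| `^ q) ->
  sum_bounded (fun m => `|a m + b m| `^ q).
Proof.
move=> q0 ha hb; apply: sum_bounded_le (sum_bounded_lin (powR_ge0 2 q) ha hb) => m.
exact: powR_normD.
Qed.

Lemma sum_bounded_powR_close (R : realType) (V : normedModType R) (q : R)
    (a b a' b' : nat -> V) : 0 <= q ->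
  sum_bounded (fun m => `|a m - a' m| `^ q) ->
  sum_bounded (fun m => `|b m - b' m| `^ q) ->
  sum_bounded (fun m => `|a m - b m| `^ q) ->
  sum_bounded (fun m => `|a' m - b' m| `^ q).
Proof.
move=> q0 ha hb hab.
have -> : (fun m => `|a' m - b' m| `^ q) =
    (fun m => `|((a m - b m) + (b m - b' m)) + (- (a m - a' m))| `^ q).
  apply/funext => m; congr (`| _ | `^ _).
  by rewrite addrA subrK opprB [RHS]addrC addrA subrK.
apply: sum_bounded_powRD => //; first exact: sum_bounded_powRD.
by under eq_fun do rewrite normrN.
Qed.

Lemma reduction_coordinatewise (R : realType) (X Y : completeNormedModType R)
    (p q : R) (theta : {ptws nat -> X} -> {ptws nat -> Y}) (f : nat -> X)
    (c : nat -> seq nat) (y0 : nat -> nat) :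
  1 <= p -> 1 <= q -> separable_space Y -> borel_map theta ->
  (forall x y, E_rel p x y <-> E_rel q (theta x) (theta y)) ->
  (forall j, y0 j \in c j) ->
  exists (l : nat -> nat) (T : nat -> nat -> nat -> Y),
  [/\ l 0%N = 0%N, forall j, (l j < l j.+1)%N &
    forall y y', (forall j, y j \in c j) -> (forall j, y' j \in c j) ->
      sum_bounded (fun j => `|f (y j) - f (y' j)| `^ p) <->
      sum_bounded (fun j =>
        \sum_(l j <= m < l j.+1) `|T j (y j) m - T j (y' j) m| `^ q)].
Proof.
move=> p1 q1 sepY borth redth y0c.
have p0 : 0 < p by exact: lt_le_trans p1.
have q0 : 0 < q by exact: lt_le_trans q1.
have [C [D [oD DC]] contC] := borel_generically_continuous f sepY borth.
pose phi w := theta (f \o w).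
have contD : generically_continuous [set w | forall i, D i w] phi.
  move=> w m e Dw e0; have [k hk] := contC w m e (DC _ Dw) e0.
  by exists k => w' Dw'; apply: hk; exact: DC.
have tail x y n : (forall i, (n <= i)%N -> x i = y i) ->
    sum_bounded (fun m => `|phi x m - phi y m| `^ q).
  move=> xy; apply/E_relE/redth/E_relE.
  exists (\sum_(0 <= i < n) `|f (x i) - f (y i)| `^ p) => N.
  have [Nn|/ltnW nN] := leqP N n.
    by apply: sum_head_le => // i; exact: powR_ge0.
  rewrite (@big_cat_nat _ _ _ n)//= gerDl big_nat_cond big1// => i.
  by rewrite andbT => /andP[ni _]; rewrite xy// subrr normr0 powR0// gt_eqF.
have [k [l [x [T [[k0 kS] [l0 lS] xk xnk xT]]]]] :=
  coordinatewise_approximation q1 (fun i => (oD i).1) (fun i => (oD i).2)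
    contD tail y0c.
exists l, T; split=> // y y' yc y'c.
have fE : sum_bounded (fun j => `|f (y j) - f (y' j)| `^ p) <->
    E_rel p (f \o x y : {ptws nat -> X}) (f \o x y').
  rewrite E_relE [X in _ <-> X](sum_bounded_blocks _ k0 kS); last first.
    by move=> n; exact: powR_ge0.
  set F := (X in _ <-> sum_bounded X).
  suff -> : F = (fun j => `|f (y j) - f (y' j)| `^ p) by [].
  apply/funext => n; rewrite /F big_ltn//= !xk big_nat_cond big1 ?addr0// => i.
  rewrite andbT => /andP[ki ik].
  rewrite (xnk y y') ?subrr ?normr0 ?powR0 ?gt_eqF//.
  move=> j ij; rewrite ij in ki ik.
  have [jn|nj] := leqP j n; first by have := strict_incr_le kS jn; lia.
  by have := strict_incr_le kS nj; lia.
have [blk hblk] := choice (strict_incr_block l0 lS).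
pose th z m := T (blk m) (z (blk m)) m.
have thE z z' : sum_bounded (fun j =>
      \sum_(l j <= m < l j.+1) `|T j (z j) m - T j (z' j) m| `^ q) <->
    sum_bounded (fun m => `|th z m - th z' m| `^ q).
  rewrite [X in _ <-> X](sum_bounded_blocks _ l0 lS); last first.
    by move=> n; exact: powR_ge0.
  suff -> : (fun j => \sum_(l j <= m < l j.+1) `|T j (z j) m - T j (z' j) m| `^ q) =
     (fun n => \sum_(l n <= i < l n.+1) `|th z i - th z' i| `^ q) by [].
  apply/funext => n; apply: eq_big_nat => m hm.
  by rewrite /th (strict_incr_block_uniq lS (hblk m) hm).
have err z : (forall j, z j \in c j) ->
    sum_bounded (fun m => `|phi (x z) m - th z m| `^ q).
  move=> zc; rewrite (sum_bounded_blocks _ l0 lS); last first.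
    by move=> n; exact: powR_ge0.
  suff -> : (fun n => \sum_(l n <= i < l n.+1) `|phi (x z) i - th z i| `^ q) =
    (fun j => \sum_(l j <= m < l j.+1) `|phi (x z) m - T j (z j) m| `^ q).
    exact: xT.
  apply/funext => n; apply: eq_big_nat => m hm.
  by rewrite /th (strict_incr_block_uniq lS (hblk m) hm).
have err' z : (forall j, z j \in c j) ->
    sum_bounded (fun m => `|th z m - phi (x z) m| `^ q).
  by move=> /err; under eq_fun do rewrite distrC.
rewrite fE redth E_relE thE; split => h.
  exact: (sum_bounded_powR_close (ltW q0) (err _ yc) (err _ y'c)).
exact: (sum_bounded_powR_close (ltW q0) (err' _ yc) (err' _ y'c)).
Qed.

(** * Selecting a subset of large average *)

Lemma seq_argmin (R : realType) (g : nat -> R) (r : seq nat) : r != [::] ->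
  exists2 x, x \in r & forall y, y \in r -> g x <= g y.
Proof.
elim: r => // a r ih _; have [->|r0] := eqVneq r [::].
  by exists a; rewrite ?mem_head// => y; rewrite inE => /eqP ->.
have [x xr hx] := ih r0; have [ax|xa] := leP (g a) (g x).
  exists a; first exact: mem_head.
  by move=> y; rewrite inE => /predU1P[->//|/hx]; exact: le_trans.
exists x; first by rewrite inE xr orbT.
by move=> y; rewrite inE => /predU1P[->|/hx//]; exact: ltW.
Qed.

Lemma large_average_subseq (R : realType) (g : nat -> R) (M d : nat) (r : seq nat) :
  uniq r -> size r = (M + d)%N -> exists s,
  [/\ uniq s, {subset s <= r}, size s = M &
   (\sum_(j <- r) g j) * M%:R <= (\sum_(j <- s) g j) * (size r)%:R].
Proof.
elim: d r => [|d ih] r ur sr.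
  by exists r; rewrite sr addn0; split.
have r0 : r != [::] by rewrite -size_eq0 sr addnS.
have [x xr hx] := seq_argmin g r0.
have sr' : size (rem x r) = (M + d)%N by rewrite size_rem// sr addnS.
have [s [us ss Ms hs]] := ih _ (rem_uniq x ur) sr'.
exists s; split=> //; first by move=> y /ss /mem_rem.
rewrite (big_rem x)//=; move: hs; rewrite sr' sr addnS -natr1.
set G := \sum_(j <- rem x r) g j; set H := \sum_(j <- s) g j.
have hG : g x * (M + d)%:R <= G.
  have -> : g x * (M + d)%:R = \sum_(j <- rem x r) g x.
    by rewrite big_const_seq count_predT iter_addr_0 mulr_natr sr'.
  by rewrite big_seq [leRHS]big_seq; apply: ler_sum => j /mem_rem /hx.
have [n0|n0] := posnP (M + d)%N.
  have M0 : M = 0%N by lia.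
  have -> : H = 0 by rewrite /H (size0nil (etrans Ms M0)) big_nil.
  by rewrite M0 mulr0n !mulr0 !mul0r.
have : (0 : R) < (M + d)%:R by rewrite ltr0n.
move: ((M + d)%:R) hG => n hG npos hs.
have M0 : (0 : R) <= M%:R by [].
rewrite -(ler_pM2r npos).
nra.
Qed.

Lemma large_average_subset (R : realType) (g : nat -> R) (a b : nat) (x e : R) :
  0 < x -> x <= e -> e <= (b - a)%:R * x ->
  exists A : pred nat,
    e <= \sum_(a <= j < b | A j) x <= 2 * e /\
    (\sum_(a <= j < b) g j) * (\sum_(a <= j < b | A j) x) <=
    (\sum_(a <= j < b | A j) g j) * ((b - a)%:R * x).
Proof.
move=> x0 xe eb.
have exM : exists M, e <= M%:R * x by exists (b - a)%N.
case: (ex_minnP exM) => M hM minM.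
have Mb : (M <= b - a)%N by exact: minM.
have hM2 : M%:R * x <= 2 * e.
  case: M hM minM {Mb} => [|M] hM minM.
    by rewrite mul0r mulr_ge0// ltW// (lt_le_trans x0).
  have : M%:R * x < e by rewrite ltNge; apply/negP => /minM; rewrite ltnn.
  rewrite -natr1 => h; nra.
have sz : size (index_iota a b) = (M + (b - a - M))%N.
  by rewrite size_iota subnKC.
have [s [us ss Ms hs]] := large_average_subseq g (iota_uniq _ _) sz.
have sumE (F : nat -> R) : \sum_(a <= j < b | j \in s) F j = \sum_(j <- s) F j.
  rewrite -big_filter; apply: perm_big; apply: uniq_perm => //.
    by rewrite filter_uniq// iota_uniq.
  by move=> j; rewrite mem_filter; case: (boolP (j \in s)) => //= /ss.
exists (mem s); rewrite /= sumE.
have -> : \sum_(j <- s) x = M%:R * x.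
  by rewrite big_const_seq count_predT iter_addr_0 Ms mulr_natl.
rewrite hM hM2; split=> //.
move: hs; rewrite size_iota -sumE.
by rewrite !mulrA => hs; rewrite ler_pM2r.
Qed.

(** * Finitely supported maps into the l_q space *)

Lemma lq_of_block (R : realType) (Y : normedModType R) (q : R) (hq : 1 <= q)
    (Z : Type) (lo hi : nat) (t : Z -> nat -> Y) (r : R) : 0 < r ->
  exists G : Z -> lq Y hq, forall a b,
    `|G a - G b| `^ q = r * \sum_(lo <= m < hi) `|t a m - t b m| `^ q.
Proof.
move=> r0; have q0 : 0 < q by exact: lt_le_trans ltr01 hq.
pose g a m : Y := if (lo <= m < hi)%N then r `^ q^-1 *: t a m else 0.
have psE (u : nat -> Y) : (forall m, ~~ (lo <= m < hi)%N -> u m = 0) ->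
    pow_series q u = (\sum_(lo <= m < hi) `|u m| `^ q)%:E.
  move=> u0; rewrite /pow_series (nneseries_split 0 lo); last first.
    by move=> k _; rewrite lee_fin powR_ge0.
  rewrite (nneseries_split (0 + lo) (hi - lo)); last first.
    by move=> k _; rewrite lee_fin powR_ge0.
  have u0p m : ~~ (lo <= m < hi)%N -> (`|u m| `^ q)%:E = 0%E.
    by move=> h; rewrite u0// normr0 powR0// gt_eqF.
  rewrite !add0n big_nat_cond big1 ?add0e => [|i]; last first.
    by rewrite andbT => /andP[_ ilo]; apply: u0p; rewrite leqNgt ilo.
  rewrite eseries0 ?adde0 => [|i]; last first.
    move=> h _; apply: u0p; rewrite negb_and -!ltnNge.
    by have [//|] := ltnP i lo => ? /=; lia.
  have [lh|hl] := leqP lo hi; first by rewrite subnKC// sumEFin.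
  by rewrite !big_geq//; lia.
have gP a : g a \in lq_pred Y q.
  by rewrite inE /= psE ?ltry// => m /negbTE h; rewrite /g h.
exists (fun a => Lq hq (gP a)) => a b.
have -> : `|Lq hq (gP a) - Lq hq (gP b)| =
    lq_norm (Lq hq (gP a) - Lq hq (gP b)) by [].
rewrite /lq_norm -powRrM mulVf ?gt_eqF// powRr1; last first.
  exact/fine_ge0/pow_series_ge0.
have -> : lq_val (Lq hq (gP a) - Lq hq (gP b)) = g a - g b by [].
have gE m : (g a - g b) m = g a m - g b m by [].
rewrite psE => [/=|m /negbTE h]; last by rewrite gE /g h subrr.
rewrite mulr_sumr; apply: eq_big_nat => m hm.
rewrite gE /g hm -scalerBr normrZ powRM// ger0_norm ?powR_ge0//.
by rewrite -powRrM mulVf ?gt_eqF// powRr1 ?ltW.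
Qed.

Lemma non_embeddable_family (R : realType) (X Y : normedModType R) (p q : R)
    (hq : 1 <= q) (B : R) : 0 < B ->
  ~ finitely_holder_embeds (p / q) (@norm_dist R X) (@norm_dist R (lq Y hq)) ->
  exists s : seq X, forall lo hi (t : X -> nat -> Y) r, 0 < r ->
    exists a b, [/\ a \in s, b \in s &
      r * (\sum_(lo <= m < hi) `|t a m - t b m| `^ q) < B^-1 * `|a - b| `^ p \/
      B * `|a - b| `^ p < r * (\sum_(lo <= m < hi) `|t a m - t b m| `^ q)].
Proof.
move=> B0 nemb; have q0 : 0 < q by exact: lt_le_trans ltr01 hq.
apply: contrapT => no; apply: nemb.
have A0 : 0 < B `^ q^-1 by exact: powR_gt0.
exists (B `^ q^-1) => // F /finite_seqP[s ->].
apply: contrapT => noT; apply: no; exists s => lo hi t r r0.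
have [G hG] := @lq_of_block R Y q hq X lo hi t r r0.
apply: contrapT => noab; apply: noT; exists (fun u => G (set_val u)) => u v.
set a := set_val u; set b := set_val v.
have as_ : a \in s by have := set_valP u.
have bs : b \in s by have := set_valP v.
have dE : `|a - b| `^ (p / q) = (`|a - b| `^ p) `^ q^-1 by rewrite powRrM.
have d0 : 0 <= `|a - b| `^ p by exact: powR_ge0.
have powR_invq_le c d : 0 <= c -> c <= d -> c `^ q^-1 <= d `^ q^-1.
  move=> c0 cd; apply: ge0_ler_powR; rewrite ?nnegrE ?invr_ge0 ?(ltW q0)//.
  exact: le_trans cd.
have BV0 : 0 <= B^-1 by rewrite invr_ge0 ltW.
have AV : (B `^ q^-1)^-1 = B^-1 `^ q^-1.
  apply: (mulfI (lt0r_neq0 A0)).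
  by rewrite mulfV ?gt_eqF// -powRM ?(ltW B0)// mulfV ?gt_eqF// powR1.
have bounds (N : R) : 0 <= N -> B^-1 * `|a - b| `^ p <= N `^ q ->
    N `^ q <= B * `|a - b| `^ p ->
    (B `^ q^-1)^-1 * `|a - b| `^ (p / q) <= N /\
    N <= B `^ q^-1 * `|a - b| `^ (p / q).
  move=> N0 h1 h2; have NE : N = (N `^ q) `^ q^-1.
    by rewrite -powRrM mulfV ?gt_eqF// powRr1.
  split.
    rewrite [leRHS]NE AV dE -powRM//; apply: powR_invq_le => //.
    exact: mulr_ge0.
  rewrite [leLHS]NE dE -powRM ?(ltW B0)//; apply: powR_invq_le => //.
  exact: powR_ge0.
have [h1 h2] : B^-1 * `|a - b| `^ p <= `|G a - G b| `^ q /\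
    `|G a - G b| `^ q <= B * `|a - b| `^ p.
  by rewrite hG; split; rewrite leNgt; apply/negP => h; apply: noab;
    exists a, b; split=> //; [left|right].
exact: (bounds _ (normr_ge0 _) h1 h2).
Qed.

Lemma seq_pair_bound (R : realType) (T : eqType) (s : seq T) (h : T -> T -> R) :
  (forall a b, 0 <= h a b) ->
  exists2 M, 0 < M & forall a b, a \in s -> b \in s -> h a b <= M.
Proof.
move=> h0; exists (1 + \sum_(a <- s) \sum_(b <- s) h a b).
  by rewrite ltr_wpDr// sumr_ge0// => a _; exact: sumr_ge0.
move=> a b as_ bs; rewrite (big_rem a)//= (big_rem b)//=.
have h1 : 0 <= \sum_(i <- rem b s) h a i by exact: sumr_ge0.
have h2 : 0 <= \sum_(i <- rem a s) \sum_(j <- s) h i j.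
  by apply: sumr_ge0 => i _; exact: sumr_ge0.
lra.
Qed.

Lemma scale_and_repeat (R : realType) (X : normedModType R) (p e : R)
    (s : seq X) : 0 < p -> 0 < e ->
  exists (lam : R) (N : nat), [/\ 0 < lam, (0 < N)%N &
    forall a b, a \in s -> b \in s ->
      `|lam *: a - lam *: b| `^ p <= e /\
      (a != b -> 1 <= N%:R * `|lam *: a - lam *: b| `^ p)].
Proof.
move=> p0 e0.
have [M M0 hM] := @seq_pair_bound R X s (fun a b => `|a - b| `^ p)
  (fun a b => powR_ge0 _ _).
have [M' M'0 hM'] := @seq_pair_bound R X s (fun a b => (`|a - b| `^ p)^-1)
  (fun a b => ltac:(by rewrite invr_ge0 powR_ge0)).
pose K := e / M; have K0 : 0 < K by rewrite divr_gt0.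
have dE a b : `|K `^ p^-1 *: a - K `^ p^-1 *: b| `^ p = K * `|a - b| `^ p.
  rewrite -scalerBr normrZ powRM// ger0_norm ?powR_ge0//.
  by rewrite -powRrM mulVf ?gt_eqF// powRr1 ?(ltW K0).
exists (K `^ p^-1), (Num.truncn (M' / K)).+1; split=> //.
  exact: powR_gt0.
move=> a b as_ bs; rewrite dE; split=> [|ab].
  have -> : e = K * M by rewrite /K divfK ?gt_eqF.
  by rewrite ler_pM2l// hM.
have d0 : 0 < `|a - b| `^ p by rewrite powR_gt0// normr_gt0 subr_eq0.
have := hM' _ _ as_ bs.
have e1 : (M' / K) * (K * M'^-1) = 1 by field; rewrite !gt_eqF.
move=> hd; rewrite -[leLHS]e1; apply: ler_pM.
- by rewrite divr_ge0// ltW.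
- by rewrite mulr_ge0// ?invr_ge0 ltW.
- by apply/ltW; exact: truncnS_gt.
- by rewrite ler_pM2l// -[leRHS]invrK lef_pV2// posrE ?invr_gt0.
Qed.

Lemma block_dichotomy (R : realType) (g : nat -> R) (a b n : nat) (x : R) :
  0 < x -> x <= 2^-1 ^+ n -> 1 <= (b - a)%:R * x ->
  \sum_(a <= j < b) g j < (4 ^+ n)^-1 * ((b - a)%:R * x) \/
    4 ^+ n * ((b - a)%:R * x) < \sum_(a <= j < b) g j ->
  exists A : pred nat,
    (\sum_(a <= j < b | A j) x <= 2 * 2^-1 ^+ n /\
     1 <= \sum_(a <= j < b | A j) g j) \/
    (1 <= \sum_(a <= j < b | A j) x /\
     \sum_(a <= j < b | A j) g j <= 2 * 2^-1 ^+ n).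
Proof.
move=> x0 xn; set w := _ * x => w1.
have w0 : 0 < w by exact: lt_le_trans w1.
have h0 : 0 < 2^-1 ^+ n :> R by rewrite exprn_gt0// invr_gt0.
have h1 : 2^-1 ^+ n <= 1 :> R by apply: exprn_ile1; lra.
have B4 : 4 ^+ n * (2^-1 ^+ n * 2^-1 ^+ n) = 1 :> R.
  have e1 : 4 * (2^-1 * 2^-1) = 1 :> R by field.
  by rewrite -!exprMn e1 expr1n.
have Bh : (4 ^+ n)^-1 = 2^-1 ^+ n * 2^-1 ^+ n :> R.
  by apply: (@mulfI _ (4 ^+ n)); rewrite ?mulfV ?expf_neq0.
case=> hG.
  have [|A [/andP[XA XA2] hA]] := @large_average_subset R (fun j => - g j)
    a b x 1 x0 (le_trans xn h1).
    exact: w1.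
  exists A; right; split=> //.
  move: hA XA XA2 hG; rewrite !sumrN Bh -/w.
  set XS := \sum_(a <= j < b | A j) x; set GS := \sum_(a <= j < b | A j) g j.
  set G := \sum_(a <= j < b) g j; set h := 2^-1 ^+ n.
  rewrite !mulNr lerN2 => hA XA XA2 hG.
  rewrite -(ler_pM2r w0); apply: le_trans hA _.
  apply: (@le_trans _ _ (h * h * w * XS)).
    by rewrite ler_wpM2r ?(ltW hG)// (le_trans ler01).
  have hh : h * h <= h by rewrite ler_piMr ?(ltW h0).
  have hh0 : 0 <= h * h by rewrite mulr_ge0 ?ltW.
  have : h * h * XS <= h * 2.
    apply: ler_pM => //; first exact: le_trans XA.
    by rewrite mulr1 in XA2.
  by move=> H; rewrite mulrAC [2 * h]mulrC ler_pM2r.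
have [|A [/andP[XA XA2] hA]] := @large_average_subset R g a b x (2^-1 ^+ n) x0 xn.
  exact: le_trans h1 w1.
exists A; left; split=> //.
move: hA XA hG; rewrite -/w.
set XS := \sum_(a <= j < b | A j) x; set GS := \sum_(a <= j < b | A j) g j.
set G := \sum_(a <= j < b) g j; set h := 2^-1 ^+ n => hA XA hG.
rewrite -(ler_pM2r w0); apply: le_trans hA.
have XS0 : 0 < XS by exact: lt_le_trans XA.
apply: (@le_trans _ _ (4 ^+ n * w * XS)); last by rewrite ler_pM2r// ltW.
rewrite mulrAC ler_pM2r//.
have B0 : 0 < 4 ^+ n :> R by exact: exprn_gt0.
apply: (@le_trans _ _ (4 ^+ n * h)); last by rewrite ler_pM2l.
by rewrite -[leLHS]B4 ler_pM2l// ler_piMr// ltW.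
Qed.

Theorem theorem1p2 (R : realType) (X Y : completeNormedModType R) (p q : R)
    (hX : separable_space X) (hY : separable_space Y)
    (hp : 1 <= p) (hq : 1 <= q) :
  borel_reducible (@E_rel R X p) (@E_rel R Y q) ->
  finitely_holder_embeds (p / q) (@norm_dist R X) (@norm_dist R (lq Y hq)).
Proof.
move=> [theta [borth redth]]; apply: contrapT => nemb.
have p0 : 0 < p by exact: lt_le_trans ltr01 hp.
have q0 : 0 < q by exact: lt_le_trans ltr01 hq.
have /choice[s hs] n := @non_embeddable_family R X Y p q hq (4 ^+ n)
  (ltac:(exact: exprn_gt0)) nemb.
have /choice[lamN hlamN] n : exists lamN : R * nat, [/\ 0 < lamN.1, (0 < lamN.2)%N &
    forall a b, a \in s n -> b \in s n ->
      `|lamN.1 *: a - lamN.1 *: b| `^ p <= 2^-1 ^+ n /\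
      (a != b -> 1 <= lamN.2%:R * `|lamN.1 *: a - lamN.1 *: b| `^ p)].
  have [|lam [N h]] := @scale_and_repeat R X p (2^-1 ^+ n) (s n) p0.
    by rewrite exprn_gt0// invr_gt0.
  by exists (lam, N).
pose lam n := (lamN n).1; pose N n := (lamN n).2.
pose P n := (\sum_(0 <= i < n) N i)%N.
have P0 : P 0%N = 0%N by rewrite /P big_geq.
have PS n : P n.+1 = (P n + N n)%N by rewrite /P big_nat_recr.
have Plt n : (P n < P n.+1)%N.
  by rewrite PS -[ltnLHS]addn0 ltn_add2l; case: (hlamN n).
have [blk hblk] := choice (strict_incr_block P0 Plt).
have blkE n j : (P n <= j < P n.+1)%N -> blk j = n.
  exact: strict_incr_block_uniq.
pose code n a : nat := pickle (n, index a (s n)).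
pose f (i : nat) : X :=
  if unpickle i is Some (n, m) then lam n *: nth 0 (s n) m else 0.
have fcode n a : a \in s n -> f (code n a) = lam n *: a.
  by move=> as_; rewrite /f /code pickleK nth_index.
pose c j := [seq pickle (blk j, i) | i <- iota 0 (size (s (blk j))).+1].
have codec j a : code (blk j) a \in c j.
  by apply/mapP; exists (index a (s (blk j))); rewrite // mem_iota ltnS index_size.
have [l [T [l0 lS red]]] := reduction_coordinatewise f hp hq hY borth redth
  (fun j => codec j 0).
have [lblk hlblk] := choice (strict_incr_block l0 lS).
pose g n a b j := \sum_(l j <= m < l j.+1)
  `|T j (code n a) m - T j (code n b) m| `^ q.
pose x n (a b : X) := `|lam n *: a - lam n *: b| `^ p.
have /choice[aA haA] n : exists aA : X * X * pred nat,
    let: (a, b, A) := aA in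
    [/\ a \in s n, b \in s n &
    (\sum_(P n <= j < P n.+1 | A j) x n a b <= 2 * 2^-1 ^+ n /\
     1 <= \sum_(P n <= j < P n.+1 | A j) g n a b j) \/
    (1 <= \sum_(P n <= j < P n.+1 | A j) x n a b /\
     \sum_(P n <= j < P n.+1 | A j) g n a b j <= 2 * 2^-1 ^+ n)].
  have [lam0 N0 hab] := hlamN n.
  have lamp : 0 < lam n `^ p by exact: powR_gt0.
  have N0r : (0 : R) < (N n)%:R by rewrite ltr0n.
  pose r := ((N n)%:R * lam n `^ p)^-1.
  have r0 : 0 < r by rewrite invr_gt0 mulr_gt0.
  have [a [b [as_ bs hr]]] := hs n (l (P n)) (l (P n.+1))
    (fun a m => T (lblk m) (code n a) m) r r0.
  have sumE : \sum_(l (P n) <= m < l (P n.+1))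
      `|T (lblk m) (code n a) m - T (lblk m) (code n b) m| `^ q =
      \sum_(P n <= j < P n.+1) g n a b j.
    rewrite -(sum_blocks _ lS (ltnW (Plt n))); apply: eq_big_nat => j _.
    apply: eq_big_nat => m hm.
    by rewrite (strict_incr_block_uniq lS (hlblk m) hm).
  have xE : x n a b = lam n `^ p * `|a - b| `^ p.
    by rewrite /x -scalerBr normrZ powRM// ger0_norm ?(ltW lam0).
  have NE : (P n.+1 - P n)%N = N n by rewrite PS addKn.
  have rE : `|a - b| `^ p = r * ((N n)%:R * x n a b).
    by rewrite xE /r; field; rewrite !gt_eqF.
  move: hr; rewrite sumE rE !(mulrCA _ r) !ltr_pM2l// -NE => hr.
  have x0 : 0 <= x n a b by exact: powR_ge0.
  have ab : a != b.
    apply/negP => /eqP ab; move: hr; rewrite ab /g /x.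
    rewrite subrr normr0 powR0 ?gt_eqF// !mulr0 big1 ?ltxx; first by case.
    by move=> j _; rewrite big1// => m _; rewrite subrr normr0 powR0// gt_eqF.
  have [hx1 /(_ ab) hx2] := hab _ _ as_ bs.
  have xpos : 0 < x n a b.
    by rewrite powR_gt0// normr_gt0 subr_eq0 (inj_eq (scalerI _))// gt_eqF.
  rewrite -/(N n) -NE in hx2.
  have [A hA] := block_dichotomy xpos hx1 hx2 hr.
  by exists (a, b, A).
pose a n := (aA n).1.1; pose b n := (aA n).1.2; pose A n := (aA n).2.
pose XS n := \sum_(P n <= j < P n.+1 | A n j) x n (a n) (b n).
pose GS n := \sum_(P n <= j < P n.+1 | A n j) g n (a n) (b n) j.
have {}haA n : [/\ a n \in s n, b n \in s n &
    (XS n <= 2 * 2^-1 ^+ n /\ 1 <= GS n) \/ (1 <= XS n /\ GS n <= 2 * 2^-1 ^+ n)].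
  by have := haA n; rewrite /XS /GS /a /b /A; case: (aA n) => [[]].
have XS0 n : 0 <= XS n by apply: sumr_ge0 => j _; exact: powR_ge0.
have g0 n u v j : 0 <= g n u v j by apply: sumr_ge0 => m _; exact: powR_ge0.
have GS0 n : 0 <= GS n by exact: sumr_ge0.
have key (V : pred nat) : sum_bounded (fun n => if V n then XS n else 0) <->
    sum_bounded (fun n => if V n then GS n else 0).
  pose y j := code (blk j) (a (blk j)).
  pose y' j := code (blk j) (if V (blk j) && A (blk j) j
    then b (blk j) else a (blk j)).
  have blockE (F : nat -> R) (G : nat -> nat -> R) :
      (forall j, F j = if V (blk j) && A (blk j) j then G (blk j) j else 0) ->
      (fun n => \sum_(P n <= j < P n.+1) F j) =
      (fun n => if V n then \sum_(P n <= j < P n.+1 | A n j) G n j else 0).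
    move=> FG; apply/funext => n.
    rewrite (eq_big_nat _ _ (F2 := fun j => if V n && A n j then G n j else 0)).
      case: (V n) => /=; last by rewrite big1.
      by rewrite [in RHS]big_mkcond.
    by move=> j hj; rewrite FG (blkE _ _ hj).
  have := red y y' (fun j => codec j _) (fun j => codec j _).
  rewrite (sum_bounded_blocks _ P0 Plt); last by move=> n; exact: powR_ge0.
  rewrite [X in _ <-> X](sum_bounded_blocks _ P0 Plt); last first.
    by move=> n; apply: sumr_ge0 => m _; exact: powR_ge0.
  rewrite (blockE _ (fun n _ => x n (a n) (b n))); last first.
    move=> j; rewrite /y /y'; case: ifP => _.
      by have [? ? _] := haA (blk j); rewrite !fcode.
    by rewrite subrr normr0 powR0// gt_eqF.
  rewrite (blockE _ (fun n j => g n (a n) (b n) j)) // => j.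
  rewrite /y /y'; case: ifP => _ //.
  by rewrite big1// => m _; rewrite subrr normr0 powR0// gt_eqF.
have geo : sum_bounded (fun n => 2 * 2^-1 ^+ n : R).
  have g2 := @sum_bounded_geometric R.
  by apply: sum_bounded_le (sum_bounded_lin ler01 g2 g2) => n; lra.
have contra (V : pred nat) (F G : nat -> R) :
    (forall n, 0 <= F n) -> (forall n, 0 <= G n) ->
    (forall n, V n -> F n <= 2 * 2^-1 ^+ n /\ 1 <= G n) ->
    (sum_bounded (fun n => if V n then F n else 0) ->
     sum_bounded (fun n => if V n then G n else 0)) ->
    exists n0, forall n, (n0 <= n)%N -> ~~ V n.
  move=> F0 G0 hV FG.
  have [||n0 hn0] := @sum_bounded_eventually_lt1 R (fun n => if V n then G n else 0).
  - by move=> n; case: ifP.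
  - apply: FG; apply: sum_bounded_le geo => n; case: ifP => [/hV[]//|_].
    by rewrite mulr_ge0// exprn_ge0// invr_ge0.
  exists n0 => n /hn0; case: ifP => // /hV[_ G1].
  by rewrite ltNge G1.
have [n1 hn1] := contra (fun n => `[< XS n <= 2 * 2^-1 ^+ n /\ 1 <= GS n >])
  XS GS XS0 GS0 (fun n => @asboolW _) (key _).1.
have [n2 hn2] := contra (fun n => `[< GS n <= 2 * 2^-1 ^+ n /\ 1 <= XS n >])
  GS XS GS0 XS0 (fun n => @asboolW _) (key _).2.
have [_ _] := haA (maxn n1 n2).
have /asboolPn no1 := hn1 _ (leq_maxl n1 n2).
have /asboolPn no2 := hn2 _ (leq_maxr n1 n2).
by case=> [//|[? ?]]; exact: no2.
Qed.
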